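(* Let $(X,d)$ be a proper metric space, consider the Lipschitz triple $(C_0(X),C_0(X),L_d)$ where $L_d$ is the usual Lipschitz seminorm, and let $\rho:C_0(X)\to\mathbb{B}(H)$ be a faithful nondegenerate representation. Then for every $T\in\mathbb{B}(H)$ the spectral propagation of $T$ coincides with the classical propagation of $T$. As a consequence, the spectral Roe algebra $C^*_{\mathrm{spec}}(C_0(X))$ coincides with the usual Roe algebra $C^*(X)$ (both formed with respect to $\rho$).
   Context: $L_d(f)=\sup_{x\neq y}|f(x)-f(y)|/d(x,y)\in[0,\infty]$. The representation $\rho$ is extended to bounded Borel functions on $X$. Spectral propagation: the infimum of the $R\ge0$ such that $\chi_{(-\infty,0]}(\rho(f))\,T\,\chi_{(R,+\infty)}(\rho(f))=0$ for all self-adjoint $f$ in the unitization of $C_0(X)$ with $L_d(f)\le1$ (Borel functional calculus), with $\inf\emptyset=\infty$. Classical propagation: $\sup\{d(x,y):(x,y)\in\mathrm{supp}(T)\}$ (with $\sup\emptyset=0$), where $\mathrm{supp}(T)=X\times X\setminus\bigcup U\times V$, the union being over open $U,V\subset X$ with $\rho(\chi_U)T\rho(\chi_V)=0$. $T$ is locally compact if $T\rho(f)$ and $\rho(f)T$ are compact for all $f\in C_0(X)$. $C^*_{\mathrm{spec}}(C_0(X))$ is the norm closure of the set of locally compact operators in $\mathbb{B}(H)$ of finite spectral propagation; $C^*(X)$ is the norm closure of the set of locally compact operators of finite classical propagation. *)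

(* Defs.v *)
From HB Require Import structures.
From mathcomp Require Import all_boot all_order all_algebra.
From mathcomp Require Import all_classical all_reals all_analysis.
From mathcomp Require Import complex.

Set Implicit Arguments.
Unset Strict Implicit.
Unset Printing Implicit Defensive.

Import Order.TTheory GRing.Theory Num.Theory.
Import numFieldNormedType.Exports.

Local Open Scope classical_set_scope.
Local Open Scope complex_scope.
Local Open Scope ring_scope.

(* The complex numbers.  The alias [^o] carries the topology; norms of
   [normedModType R[i]] spaces are elements of [R[i]] (real and nonnegative). *)
Notation "'CC' R" := (R[i]^o)%type (at level 10, R at level 9).

Section FunctionClasses.
Context {R : realType} {T : topologicalType}.

Definition C0 : set (T -> CC R) := [set f | continuous f /\
  forall e : R, 0 < e ->
    exists2 K : set T, compact K & forall x, ~ K x -> `|f x| < e%:C].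

Definition bounded_borel : set (T -> CC R) := [set f |
  (exists M : R, forall x, `|f x| <= M%:C) /\
  forall U : set (CC R), open U -> <<s [set V : set T | open V] >> (f @^-1` U)].

End FunctionClasses.

Definition proper_metric (R : realType) (X : metricType R) : Prop :=
  forall (x : X) (r : R), compact [set y | mdist x y <= r].

Section Metric.
Context {R : realType} {X : metricType R}.

(* 0 is adjoined so that the supremum lies in [0, +oo] when X has at most one
   point; [complex.Re] turns the complex-valued modulus into a real. *)
Definition lip_seminorm (f : X -> CC R) : \bar R :=
  ereal_sup ([set 0%E] `|`
    [set r | exists x y : X, x != y /\
       r = (complex.Re `|f x - f y| / mdist x y)%:E]).

End Metric.

Section Operators.
Context {R : realType} {H : completeNormedModType R[i]}.
(* The inner product, linear in the first argument. *)
Variable ip : {dot H for (@Num.conj R[i])}.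

Definition bounded_op : set (H -> H) := [set T | linear T /\ continuous T].

Definition compact_op (T : H -> H) : Prop :=
  bounded_op T /\ compact (closure (T @` [set v : H | `|v| <= 1])).

Definition op_norm_closure (S : set (H -> H)) : set (H -> H) :=
  [set T | bounded_op T /\ forall e : R, 0 < e ->
    exists2 T', S T' & forall v, `|T v - T' v| <= e%:C * `|v|].

(* [phi] restricted to the *-algebra of functions [A] is a *-homomorphism into
   the bounded operators; its values outside [A] are irrelevant. *)
Record star_hom (T : Type) (A : set (T -> CC R)) (phi : (T -> CC R) -> H -> H) :
    Prop := StarHom {
  star_hom_bounded : forall f, A f -> bounded_op (phi f) ;
  star_hom_linear : forall (a : R[i]) f g, A f -> A g -> forall v,
    phi (fun x => a * f x + g x) v = a *: phi f v + phi g v ;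
  star_hom_mul : forall f g, A f -> A g -> forall v,
    phi (fun x => f x * g x) v = phi f (phi g v) ;
  star_hom_adj : forall f, A f -> forall u v,
    ip (phi f u) v = ip u (phi (fun x => Num.conj (f x : R[i])) v) }.

(* Continuity along uniformly bounded, pointwise convergent sequences, for the
   weak operator topology: equivalently, each f |-> ip (phi f u) v is the
   integral against a complex measure. *)
Definition sigma_normal (T : topologicalType) (phi : (T -> CC R) -> H -> H) :
    Prop :=
  forall (f_ : nat -> T -> CC R) (f : T -> CC R) (M : R),
    (forall n, bounded_borel (f_ n)) ->
    (forall n x, `|f_ n x| <= M%:C) ->
    (forall x, f_ n x @[n --> \oo] --> f x) ->
    forall u v : H,
      (ip (phi (f_ n) u) v : CC R) @[n --> \oo] --> (ip (phi f u) v : CC R).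

(* [Phi h] is h(a) for bounded Borel h on the line: [Phi] is integration against
   the spectral measure of [a], which is supported in a compact interval on which
   the identity function integrates to [a].  This determines [Phi] on bounded
   Borel functions. *)
Definition is_borel_calculus (a : H -> H) (Phi : (R -> CC R) -> H -> H) : Prop :=
  [/\ star_hom bounded_borel Phi, sigma_normal Phi &
      exists M : R,
        (forall v, Phi (\1_(`[- M, M])) v = v) /\
        (forall v, Phi (fun t : R => t%:C * \1_(`[- M, M]) t) v = a v)].

(* Borel functional calculus; meaningful for self-adjoint bounded [a]. *)
Definition borel_calculus (a : H -> H) : (R -> CC R) -> H -> H :=
  xget (fun _ _ => 0) [set Phi | is_borel_calculus a Phi].

End Operators.

Section Representations.
Context {R : realType} {X : metricType R} {H : completeNormedModType R[i]}.
Variable ip : {dot H for (@Num.conj R[i])}.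

Implicit Types (rho rhoB : (X -> CC R) -> H -> H) (T : H -> H).

Definition representation rho : Prop := star_hom ip C0 rho.

Definition faithful_rep rho : Prop :=
  forall f, C0 f -> (forall v, rho f v = 0) -> forall x, f x = 0.

(* The linear span of rho(C_0(X))H is dense in H. *)
Definition nondegenerate_rep rho : Prop :=
  closure [set w : H | exists (n : nat) (f : 'I_n -> X -> CC R) (v : 'I_n -> H),
    (forall i, C0 (f i)) /\ w = \sum_(i < n) rho (f i) (v i)] = setT.

(* [rhoB] is the (unique) extension of [rho] to bounded Borel functions. *)
Definition borel_extension rho rhoB : Prop :=
  [/\ star_hom ip bounded_borel rhoB, sigma_normal ip rhoB &
      forall f, C0 f -> forall v, rhoB f v = rho f v].

(* Elements of the unitization are pairs (f, c), standing for f + c1. *)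
Definition unitization_fun (f : X -> CC R) (c : R[i]) : X -> CC R :=
  fun x => f x + c.

Definition unitization_rep rho (f : X -> CC R) (c : R[i]) : H -> H :=
  fun v => rho f v + c *: v.

Definition unitization_selfadj (f : X -> CC R) (c : R[i]) : Prop :=
  [/\ C0 f, forall x, Num.conj (f x : R[i]) = f x & Num.conj c = c].

Definition spectral_propagation rho T : \bar R :=
  ereal_inf [set r%:E | r in [set r : R | 0 <= r /\
    forall f c, unitization_selfadj f c ->
      (lip_seminorm (unitization_fun f c) <= 1)%E ->
      let a := unitization_rep rho f c in
      forall v, borel_calculus ip a (\1_(`]-oo, 0]))
        (T (borel_calculus ip a (\1_(`]r, +oo[)) v)) = 0]].

Definition op_support rhoB T : set (X * X) :=
  ~` \bigcup_(W in [set W : set X * set X | [/\ open W.1, open W.2 &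
         forall v, rhoB (\1_(W.1)) (T (rhoB (\1_(W.2)) v)) = 0]])
       (W.1 `*` W.2).

(* 0 is adjoined because of the convention that the empty supremum is 0. *)
Definition classical_propagation rhoB T : \bar R :=
  ereal_sup ([set 0%E] `|`
    [set (mdist p.1 p.2)%:E | p in op_support rhoB T]).

Definition locally_compact_op rho T : Prop :=
  bounded_op T /\ forall f, C0 f ->
    compact_op (T \o rho f) /\ compact_op (rho f \o T).

Definition spectral_roe_algebra rho : set (H -> H) :=
  op_norm_closure
    [set T | locally_compact_op rho T /\ (spectral_propagation rho T < +oo)%E].

Definition roe_algebra rho rhoB : set (H -> H) :=
  op_norm_closure
    [set T | locally_compact_op rho T /\ (classical_propagation rhoB T < +oo)%E].

End Representations.

(* Main.v *)
(* The Borel calculus of a = rho(f) + c is h |-> rhoB (h \o g) with g = f + c, so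
   the spectral projections of a are the multiplication projections of the sets
   {g <= 0} and {g > r}.  This needs uniqueness of the calculus on rays: two
   calculi agree on the function t, hence on bounded pointwise limits of
   polynomials in t, among them the sign function.

   If a 1-Lipschitz g satisfies g x <= 0 and g y > r, then d(x, y) > r, so when r
   bounds the classical propagation {g <= 0} x {g > r} avoids supp(T).  On compact
   K x L inside it finitely many rectangles killing T suffice, and
   sigma-compactness with normality of rhoB gives the vanishing on the whole set.
   Conversely, when d(x, y) > r the truncated distance
   g = min(d(x, .), d(x, y)) - (d(x, y) - r) / 2 separates neighbourhoods of x
   and y. *)
Require Import Defs.
From mathcomp Require Import all_boot all_order all_algebra.
From mathcomp Require Import all_classical all_reals all_analysis.
From mathcomp Require Import measurable_realfun complex.
From mathcomp Require Import ring lra.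

Set Implicit Arguments.
Unset Strict Implicit.
Unset Printing Implicit Defensive.

Import Order.TTheory GRing.Theory Num.Theory.
Import numFieldNormedType.Exports.
Local Open Scope classical_set_scope.
Local Open Scope complex_scope.
Local Open Scope ring_scope.

(* If P K failed, the sets A with P (K `\` A) would form a proper filter containing
   K and without cluster point in K. *)
Lemma compact_ideal (T : topologicalType) (P : set T -> Prop) (K : set T) :
  P set0 -> (forall A B, A `<=` B -> P B -> P A) ->
  (forall A B, P A -> P B -> P (A `|` B)) ->
  compact K -> (forall x, K x -> exists2 U, nbhs x U & P U) -> P K.
Proof.
move=> P0 PS PU cK Ploc; apply: contrapT => nPK.
pose F : set_system T := [set A | P (K `\` A)].
have FF : ProperFilter F.
  split; first by rewrite /F/= setD0.
  split; rewrite /F/=.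
  - by rewrite setDT.
  - by move=> A B PA PB; rewrite /= setDIr; apply: PU.
  - by move=> A B AB; apply: PS => x [Kx nBx]; split=> // /AB.
have FK : F K by rewrite /F/= setDv.
have [x [Kx clx]] := cK F FF FK.
have [U Ux PUx] := Ploc x Kx.
have FU : F (~` U) by rewrite /F/= setDE setCK; apply: PS PUx; exact: subIsetr.
by have [y []] := clx _ _ FU Ux.
Qed.

Lemma norm_indic_le1 {R : realType} {T : Type} (A : set T) x :
  `|(\1_A : T -> CC R) x| <= 1%:C.
Proof.
by rewrite indicE; case: (x \in A); rewrite ?normr1 ?normr0;
  [exact: lexx|exact: ler01].
Qed.

(** * Borel sets and functions *)

Section BorelSets.
Context {T : topologicalType}.
Local Notation borel := (<<s [set V : set T | open V] >>).

Lemma borel_open (A : set T) : open A -> borel A.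
Proof. by move=> oA; exact: sub_sigma_algebra. Qed.

Lemma borelC (A : set T) : borel A -> borel (~` A).
Proof. by move=> bA; rewrite -setTD; exact: sigma_algebraCD. Qed.

Lemma borelU (A B : set T) : borel A -> borel B -> borel (A `|` B).
Proof.
move=> bA bB; rewrite -bigcup2E; apply: sigma_algebra_bigcup => -[|[|n]] //=.
exact: sigma_algebra0.
Qed.

Lemma borelI (A B : set T) : borel A -> borel B -> borel (A `&` B).
Proof.
by move=> bA bB; rewrite -[A `&` B]setCK setCI;
  apply: borelC; apply: borelU; apply: borelC.
Qed.

Lemma borelD (A B : set T) : borel A -> borel B -> borel (A `\` B).
Proof. by move=> bA bB; rewrite setDE; apply: borelI => //; exact: borelC. Qed.

Lemma borel_closed (A : set T) : closed A -> borel A.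
Proof.
move=> cA; rewrite -[A]setCK; apply: borelC; apply: borel_open.
exact: closed_openC.
Qed.

Lemma bounded_borel_indic {R : realType} (A : set T) :
  borel A -> bounded_borel (\1_A : T -> CC R).
Proof.
move=> bA; split.
  by exists 1 => x; exact: norm_indic_le1.
move=> U _.
(* The preimage of [U] depends only on which of the values 1 and 0 lie in [U], so it is the whole
   space, [A], its complement, or empty. *)
have [U1|U1] := pselect (U 1); have [U0|U0] := pselect (U 0).
- rewrite (_ : _ @^-1` _ = setT) ?eqEsubset; first exact: borel_open openT.
  by split=> // x _ /=; rewrite indicE; case: (x \in A).
- rewrite (_ : _ @^-1` _ = A) //; apply/seteqP; split=> x /=; rewrite indicE.
    by have [/set_mem|] := boolP (x \in A).
  by move=> Ax; rewrite mem_set.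
- rewrite (_ : _ @^-1` _ = ~` A) //; first exact: borelC.
  apply/seteqP; split=> x /=; rewrite indicE.
    by have [|/negP nAx _ Ax] := boolP (x \in A) => //; apply/nAx/mem_set.
  by move=> nAx; rewrite memNset.
- rewrite (_ : _ @^-1` _ = set0) ?eqEsubset; first exact: sigma_algebra0.
  by split=> // x /=; rewrite indicE; case: (x \in A).
Qed.

End BorelSets.

(** The sets whose preimage under [g] is Borel form a sigma-algebra containing the open sets, hence
    contain every Borel set. *)
Lemma bounded_borel_comp {R : realType} {S T : topologicalType} (h : T -> CC R)
    (g : S -> T) :
  continuous g -> bounded_borel h -> bounded_borel (h \o g).
Proof.
move=> cg [[M hM] bh]; split; first by exists M => x; exact: hM.
move=> U oU.
pose Q : set (set T) := [set A | <<s [set V : set S | open V] >> (g @^-1` A)].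
suff : <<s [set V : set T | open V] >> `<=` Q by move=> /(_ _ (bh _ oU)).
apply: smallest_sub; last first.
  by move=> A oA; apply: borel_open; apply: open_comp => // x _; exact: cg.
split; rewrite /Q/=.
- by rewrite preimage_set0; exact: sigma_algebra0.
- by move=> A QA; rewrite setTD preimage_setC -setTD; exact: sigma_algebraCD.
- by move=> A QA; rewrite preimage_bigcup; exact: sigma_algebra_bigcup.
Qed.

(** * Multiplication projections *)

Section Calculus.
Context {R : realType} {H : completeNormedModType R[i]}.
Variable ip : {dot H for (@Num.conj R[i])}.
Hypothesis ip_norm : forall v : H, `|v| ^+ 2 = ip v v.
Context {T : topologicalType} (phi : (T -> CC R) -> H -> H).
Hypothesis phi_hom : star_hom ip bounded_borel phi.

Local Notation borel := (<<s [set V : set T | open V] >>).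

Lemma bounded_op0 (S : H -> H) : bounded_op S -> S 0 = 0.
Proof.
by case=> lS _; have := lS (-1) 0 0; rewrite scaler0 addr0 scaleN1r addNr.
Qed.

Lemma bounded_opD (S : H -> H) u v : bounded_op S -> S (u + v) = S u + S v.
Proof. by case=> lS _; have := lS 1 u v; rewrite !scale1r. Qed.

Lemma star_hom_indicI A B v : borel A -> borel B ->
  phi (\1_(A `&` B)) v = phi (\1_A) (phi (\1_B) v).
Proof.
move=> bA bB; rewrite -(star_hom_mul phi_hom); do ?exact: bounded_borel_indic.
by congr (phi _ _); apply/funext => x; rewrite indicI.
Qed.

Lemma star_hom_indic0 v : phi (\1_set0) v = 0.
Proof.
have b0 : bounded_borel (\1_(@set0 T) : T -> CC R).
  by apply: bounded_borel_indic; exact: sigma_algebra0.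
have := star_hom_linear phi_hom (-1) b0 b0 v; rewrite scaleN1r addNr => <-.
by congr (phi _ _); apply/funext => x; rewrite indic0 mulr0 addr0.
Qed.

Lemma star_hom_indicU A B v : borel A -> borel B ->
  phi (\1_(A `|` B)) v = phi (\1_A) v + phi (\1_(B `\` A)) v.
Proof.
move=> bA bB; have bD := borelD bB bA.
rewrite -[phi (\1_A) v]scale1r -(star_hom_linear phi_hom);
  do ?exact: bounded_borel_indic.
congr (phi _ _); apply/funext => x; rewrite mul1r !indicE in_setU in_setD.
by case: (x \in A); case: (x \in B); rewrite ?addr0 ?add0r.
Qed.

Lemma star_hom_indic_adj A u v : borel A ->
  ip (phi (\1_A) u) v = ip u (phi (\1_A) v).
Proof.
move=> bA; rewrite (star_hom_adj phi_hom); last exact: bounded_borel_indic.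
congr (ip _ (phi _ _)); apply/funext => x; rewrite indicE.
by case: (x \in A); rewrite ?conjC1 ?conjC0.
Qed.

Hypothesis phi_normal : sigma_normal ip phi.

(** Normality only gives weak convergence. For a self-adjoint idempotent P the identity |P v|^2 = ip
    (P v) v turns it into norm convergence. *)
Lemma sigma_normal_indic_cvg0 (D : nat -> set T) v :
  (forall n, borel (D n)) -> (forall x, \forall n \near \oo, ~ D n x) ->
  phi (\1_(D n)) v @[n --> \oo] --> 0.
Proof.
move=> bD D0; apply/cvgr0Pnorm_lt => e e0.
have normE n : `|phi (\1_(D n)) v| ^+ 2 = ip (phi (\1_(D n)) v) v.
  by rewrite ip_norm star_hom_indic_adj// -star_hom_indicI// setIid
    -star_hom_indic_adj.
have := @phi_normal (fun n => \1_(D n)) (\1_set0) 1 _ _ _ v v.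
rewrite star_hom_indic0 linear0l.
have h1 n : bounded_borel (\1_(D n) : T -> CC R) by exact: bounded_borel_indic.
have h2 n x : `|(\1_(D n) : T -> CC R) x| <= 1%:C.
  exact: norm_indic_le1.
have h3 x : (\1_(D n) : T -> CC R) x @[n --> \oo] --> (\1_set0 : T -> CC R) x.
  apply: cvg_near_cst; near=> n; rewrite indic0 indicE memNset //.
  by near: n; exact: D0.
move=> /(_ h1 h2 h3) /cvgr0Pnorm_lt /(_ (e ^+ 2)) /(_ (exprn_gt0 _ e0)).
apply: filterS => n; rewrite -normE normrX normr_id.
by rewrite ltr_pXn2r// nnegrE// ltW.
Unshelve. all: by end_near. Qed.

(** Splitting [B] into [A n] and [B \ A n] shows that S (phi (1_(B \ A n)) v) does not depend on
    [n]; it also tends to 0, because the remainders eventually leave every point. *)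
Lemma sigma_normal_indic_limit (S : H -> H) (A : nat -> set T) B v :
  bounded_op S -> borel B -> (forall n, borel (A n)) -> (forall n, A n `<=` B) ->
  (forall x, B x -> \forall n \near \oo, A n x) ->
  (forall n, S (phi (\1_(A n)) v) = 0) -> S (phi (\1_B) v) = 0.
Proof.
move=> bS bB bA AB Acvg SA.
have SE n : S (phi (\1_(B `\` A n)) v) = S (phi (\1_B) v).
  have {2}-> : B = A n `|` B by rewrite setUidr.
  by rewrite star_hom_indicU// bounded_opD// SA add0r.
have Dcvg : phi (\1_(B `\` A n)) v @[n --> \oo] --> 0.
  apply: sigma_normal_indic_cvg0 => [n|x]; first exact: borelD.
  have [Bx|nBx] := pselect (B x); last by apply: nearW => n [].
  by apply: filterS (Acvg x Bx) => n Anx [].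
have : S (phi (\1_(B `\` A n)) v) @[n --> \oo] --> S 0.
  by apply: continuous_cvg Dcvg; case: bS => _; apply.
under eq_fun do rewrite SE.
rewrite bounded_op0// => /(cvg_lim (@norm_hausdorff _ _)) <-.
by rewrite lim_cst.
Qed.

(** * Pairs of Borel sets whose projections annihilate an operator *)

Section NullPairs.
Variable S : H -> H.
Hypothesis bS : bounded_op S.

Definition null_pair A B : Prop :=
  forall v, phi (\1_A) (S (phi (\1_B) v)) = 0.

Lemma star_hom_indic_op A : borel A -> bounded_op (phi (\1_A)).
Proof. by move=> bA; apply: (star_hom_bounded phi_hom); exact: bounded_borel_indic. Qed.

(** The projection of a smaller set absorbs that of a larger one, so the projections of [A] and [B]
    can be inserted next to [S]. *)
Lemma null_pair_mono A A' B B' : borel A -> borel A' -> borel B -> borel B' ->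
  A' `<=` A -> B' `<=` B -> null_pair A B -> null_pair A' B'.
Proof.
move=> bA bA' bB bB' /setIidPl AA' /setIidPr BB' nAB v.
by rewrite -AA' -BB' !star_hom_indicI// nAB (bounded_op0 (star_hom_indic_op bA')).
Qed.

Lemma null_pairUl A A' B : borel A -> borel A' -> borel B ->
  null_pair A B -> null_pair A' B -> null_pair (A `|` A') B.
Proof.
move=> bA bA' bB nAB nA'B v; rewrite star_hom_indicU// nAB add0r.
by apply: (null_pair_mono bA' _ bB bB) => //; exact: borelD.
Qed.

Lemma null_pairUr A B B' : borel A -> borel B -> borel B' ->
  null_pair A B -> null_pair A B' -> null_pair A (B `|` B').
Proof.
move=> bA bB bB' nAB nAB' v; rewrite star_hom_indicU// !bounded_opD//;
  last exact: star_hom_indic_op.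
by rewrite nAB add0r; apply: (null_pair_mono bA bA bB') => //; exact: borelD.
Qed.

(** The tube lemma argument: compactness of [L] for each fixed point of [K], then compactness of
    [K]. In each pass unions are taken on the side being covered and intersections on the other. *)
Lemma null_pair_compact K L : compact K -> compact L -> borel K -> borel L ->
  (forall x y, K x -> L y ->
     exists U V, [/\ open U, open V, U x, V y & null_pair U V]) ->
  null_pair K L.
Proof.
move=> cK cL bK bL loc.
have null0l B : null_pair set0 B by move=> v; exact: star_hom_indic0.
have null0r A : borel A -> null_pair A set0.
  by move=> bA v; rewrite star_hom_indic0 !bounded_op0//; exact: star_hom_indic_op.
have tube x : K x -> exists U V,
    [/\ open U, U x, open V, L `<=` V & null_pair U V].
  move=> Kx.
  (* The neighbourhood [U] of the fixed [x] shrinks while [V] grows to cover [L]. *)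
  pose P L' := exists U V, [/\ open U, U x, open V, L' `<=` V & null_pair U V].
  apply: (@compact_ideal T P L) => //.
  - exists setT, set0; split=> //; [exact: openT|exact: open0|].
    by apply: null0r; apply: borel_open; exact: openT.
  - move=> A B AB [U [V [oU Ux oV BV nUV]]]; exists U, V; split=> //.
    exact: subset_trans BV.
  - move=> A B [U [V [oU Ux oV AV nUV]]] [U' [V' [oU' Ux' oV' BV' nUV']]].
    exists (U `&` U'), (V `|` V'); split=> //.
    + exact: openI.
    + exact: openU.
    + exact: setUSS.
    + apply: null_pairUr; do ?[exact: borel_open|exact: (borel_open (openI oU oU'))].
      * by apply: null_pair_mono nUV => //; do ?exact: borel_open;
          exact: (borel_open (openI oU oU')).
      * by apply: null_pair_mono nUV' => //; do ?exact: borel_open;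
          exact: (borel_open (openI oU oU')).
  - move=> y Ly; have [U [V [oU oV Ux Vy nUV]]] := loc x y Kx Ly.
    exists V; first by apply: open_nbhs_nbhs; split.
    by exists U, V; split.
(* The roles are exchanged: [U] grows to cover [K], while [V] shrinks but always contains [L]. *)
pose P K' := exists U V,
  [/\ open U, K' `<=` U, open V, L `<=` V & null_pair U V].
suff [U [V [oU KU oV LV nUV]]] : P K.
  by apply: null_pair_mono nUV => //; exact: borel_open.
apply: compact_ideal => //.
- by exists set0, setT; split=> //; [exact: open0|exact: openT].
- move=> A B AB [U [V [oU BU oV LV nUV]]]; exists U, V; split=> //.
  exact: subset_trans BU.
- move=> A B [U [V [oU AU oV LV nUV]]] [U' [V' [oU' BU' oV' LV' nUV']]].
  have oVV' := openI oV oV'.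
  exists (U `|` U'), (V `&` V'); split=> //.
  + exact: openU.
  + exact: setUSS.
  + by move=> y Ly; split; [exact: LV|exact: LV'].
  + apply: null_pairUl; do ?exact: borel_open.
    * by apply: null_pair_mono nUV => //; exact: borel_open.
    * by apply: null_pair_mono nUV' => //; exact: borel_open.
- move=> x Kx; have [U [V [oU Ux oV LV nUV]]] := tube x Kx.
  exists U; first by apply: open_nbhs_nbhs; split.
  by exists U, V; split.
Qed.

(** Two successive limits: first in [B], for the operator [S] followed by the projection of [A0],
    then in [A] for each fixed [B m]. *)
Lemma null_pair_limit (A B : nat -> set T) A0 B0 :
  (forall n, borel (A n)) -> (forall n, borel (B n)) -> borel A0 -> borel B0 ->
  (forall n, A n `<=` A0) -> (forall n, B n `<=` B0) ->
  (forall x, A0 x -> \forall n \near \oo, A n x) ->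
  (forall x, B0 x -> \forall n \near \oo, B n x) ->
  (forall n m, null_pair (A n) (B m)) -> null_pair A0 B0.
Proof.
move=> bA bB bA0 bB0 AA0 BB0 Acvg Bcvg nAB v.
apply: (@sigma_normal_indic_limit (phi (\1_A0) \o S) B) => // [|m].
  have [lS cS] := bS; have [lA cA] := star_hom_indic_op bA0; split.
    by move=> a u w /=; rewrite lS lA.
  by move=> u; apply: continuous_comp; [exact: cS|exact: cA].
(* In the second limit nothing acts after the projection of [A n], so the operator is the
   identity. *)
have bid : bounded_op (@id H) by split; [move=> a u w|move=> u; exact: cvg_id].
by apply: (sigma_normal_indic_limit bid bA0 bA AA0 Acvg) => n; exact: nAB.
Qed.

End NullPairs.

End Calculus.

(** * Real measurable functions as bounded Borel functions *)

Section RealFunctions.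
Context {R : realType}.

Lemma norm_real_complex (x : R) : `|x%:C : R[i]| = `|x|%:C.
Proof. by rewrite normc_def /= expr0n addr0 sqrtr_sqr. Qed.

Lemma real_complex_continuous : continuous (fun x : R => x%:C : CC R).
Proof.
move=> x; apply/cvgrPdist_lt => e e0; near=> y.
rewrite -rmorphB norm_real_complex -(RRe_real (gtr0_real e0)) ltcR.
near: y; apply: (@cvgr_dist_lt _ _ _ _ _ id x); first exact: cvg_id.
by move: e0; rewrite ltcE => /andP[].
Unshelve. all: by end_near. Qed.

Lemma Re_continuous : continuous (fun z : CC R => complex.Re z : R).
Proof.
move=> z; apply/(@cvgrPdist_lt _ _ _ (nbhs (z : CC R))) => e e0; near=> w.
have := normc_ge_Re (z - w : R[i]); rewrite raddfB -ltcR => /le_lt_trans; apply.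
near: w; apply: (@cvgr_dist_lt _ _ _ _ _ id z); first exact: cvg_id.
by rewrite ltcR.
Unshelve. all: by end_near. Qed.

Lemma measurable_borel (A : set R) :
  measurable A -> <<s [set V : set R | open V] >> A.
Proof.
move=> mA; have : (@RGenOpens.G R).-sigma.-measurable A.
  by rewrite -RGenOpens.measurableE; exact: mA.
apply: sub_sigma_algebra2 => _ [x [y ->]]; exact: interval_open.
Qed.

Lemma bounded_borel_real (F : R -> R) (M : R) :
  measurable_fun setT F -> (forall t, `|F t| <= M) ->
  bounded_borel (fun t => (F t)%:C : CC R).
Proof.
move=> mF FM; split; first by exists M => t; rewrite norm_real_complex lecR.
move=> U oU; apply: measurable_borel.
rewrite -[X in measurable X]setTI.
apply: (mF measurableT ((fun x : R => x%:C : CC R) @^-1` U)).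
apply: open_measurable; apply: open_comp => // x _.
exact: real_complex_continuous.
Qed.

Lemma real_complex_indic (A : set R) :
  (fun t => (\1_A t)%:C : CC R) = \1_A.
Proof. by apply/funext => t; rewrite !indicE rmorph_nat. Qed.

Lemma abs_indic_le1 (A : set R) t : `|\1_A t : R| <= 1.
Proof. by rewrite indicE; case: (t \in A); rewrite ?normr1 ?normr0. Qed.

(** If the projection of [D] is the identity, the spectral measure lives on [D]: multiplying by the
    indicator of [D] changes no operator, so only values on [D] count. *)
Lemma star_hom_supported {H : completeNormedModType R[i]}
    (ip : {dot H for (@Num.conj R[i])}) (Phi : (R -> CC R) -> H -> H)
    (D : set R) f g v :
  star_hom ip bounded_borel Phi -> measurable D ->
  (forall w, Phi (\1_D) w = w) -> bounded_borel f -> bounded_borel g ->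
  (forall t, D t -> f t = g t) -> Phi f v = Phi g v.
Proof.
move=> hom mD PhiD bf bg fg.
have bD : bounded_borel (\1_D : R -> CC R).
  by apply: bounded_borel_indic; exact: measurable_borel.
rewrite -[in LHS](PhiD v) -[in RHS](PhiD v).
rewrite -(star_hom_mul hom bf bD) -(star_hom_mul hom bg bD).
congr (Phi _ _); apply/funext => t; rewrite indicE.
by have [/set_mem /fg ->//|_] := boolP (t \in D); rewrite !mulr0.
Qed.

End RealFunctions.

(** * Uniqueness of the Borel calculus on rays *)

(* Newton's iteration for u^2 = 1, here started from x in [-1, 1]: it makes the sign
   of x a pointwise limit of polynomials in x bounded by 1 on [-1, 1]. *)
Definition newton_sign {R : realType} (x : R) : R := x * (3 - x ^+ 2) / 2.

Section Newton.
Context {R : realType}.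
Implicit Type x : R.

Lemma newton_signN x : newton_sign (- x) = - newton_sign x.
Proof. by rewrite /newton_sign sqrrN; ring. Qed.

Lemma newton_sign_bounds x : 0 <= x <= 1 -> x <= newton_sign x <= 1.
Proof.
rewrite /newton_sign => /andP[x0 x1].
(* The two products are twice [newton_sign x - x] and twice [1 - newton_sign x]. *)
have h1 : 0 <= x * ((1 - x) * (1 + x)) by rewrite !mulr_ge0//; lra.
have h2 : 0 <= (1 - x) ^+ 2 * (2 + x) by rewrite mulr_ge0 ?sqr_ge0//; lra.
by apply/andP; split; lra.
Qed.

Lemma newton_sign_le1 x : `|x| <= 1 -> `|newton_sign x| <= 1.
Proof.
rewrite /newton_sign !ler_norml => /andP[x0 x1].
have h1 : 0 <= (1 - x) ^+ 2 * (2 + x) by rewrite mulr_ge0 ?sqr_ge0//; lra.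
have h2 : 0 <= (1 + x) ^+ 2 * (2 - x) by rewrite mulr_ge0 ?sqr_ge0//; lra.
by apply/andP; split; lra.
Qed.

Lemma iter_newton_le1 x n : `|x| <= 1 -> `|iter n newton_sign x| <= 1.
Proof. by move=> x1; elim: n => [//|n IH] /=; exact: newton_sign_le1. Qed.

(** From a start y in ]0, 1] the iterates stay in [y, 1], and each step shrinks the distance to 1 by
    the factor 1 - y / 2 at least. Negative starts follow by oddness, and 0 is a fixed point. *)
Lemma newton_sign_cvg x : `|x| <= 1 ->
  iter n newton_sign x @[n --> \oo] --> Num.sg x.
Proof.
have pos y : 0 < y -> `|y| <= 1 ->
    iter n newton_sign y @[n --> \oo] --> (1 : R).
  move=> y0; rewrite gtr0_norm// => y1.
  have it n : y <= iter n newton_sign y <= 1 /\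
      1 - iter n newton_sign y <= (1 - y / 2) ^+ n.
    elim: n => [|n /= [/andP[yn n1] IH]]; first by rewrite expr0; split=> /=; lra.
    have /andP[le1 le2] :
        iter n newton_sign y <= newton_sign (iter n newton_sign y) <= 1.
      by apply: newton_sign_bounds; rewrite n1 andbT (le_trans (ltW y0)) .
    split; first by rewrite le2 andbT (le_trans yn).
    rewrite exprS; apply: le_trans (ler_wpM2l _ IH); last by lra.
    set u := iter n newton_sign y in yn n1 *.
    (* This product is twice the difference between (1 - y / 2) (1 - u) and 1 - [newton_sign u]; it
       is nonnegative because y <= u <= 1. *)
    have h : 0 <= (1 - u) * (u * u + (u - y)).
      have u0 : 0 <= u by exact: le_trans (ltW y0) yn.
      by apply: mulr_ge0; [lra|apply: addr_ge0; [exact: mulr_ge0|lra]].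
    by rewrite /newton_sign; lra.
  have geo : (1 - y / 2) ^+ n @[n --> \oo] --> (0 : R).
    by apply: cvg_expr; rewrite ger0_norm; lra.
  apply: (@squeeze_cvgr _ _ _ _ (fun n => 1 - (1 - y / 2) ^+ n) (cst 1)).
  - by apply: nearW => n; have [/andP[_ n1] h] := it n; apply/andP; split=> //=; lra.
  - by rewrite -[X in _ --> X]subr0; apply: cvgB => //; exact: cvg_cst.
  - exact: cvg_cst.
have [x0|x0|->] := ltgtP x 0 => x1.
- rewrite ltr0_sg// -[x]opprK.
  have itN (y : R) n : iter n newton_sign (- y) = - iter n newton_sign y.
    by elim: n => [//|n /= ->]; exact: newton_signN.
  under eq_fun do rewrite itN.
  by apply: cvgN; apply: pos; rewrite ?oppr_gt0 ?normrN.
- by rewrite gtr0_sg//; exact: pos.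
- rewrite sgr0; apply: cvg_near_cst; apply: nearW; elim=> [//|n /= ->].
  by rewrite /newton_sign !mul0r.
Qed.

End Newton.

(** * Functions on which two Borel calculi agree *)

Section Uniqueness.
Context {R : realType} {H : completeNormedModType R[i]}.
Variable ip : {dot H for (@Num.conj R[i])}.
Variables Phi Psi : (R -> CC R) -> H -> H.
Hypothesis Phi_hom : star_hom ip bounded_borel Phi.
Hypothesis Psi_hom : star_hom ip bounded_borel Psi.
Hypothesis Phi_normal : sigma_normal ip Phi.
Hypothesis Psi_normal : sigma_normal ip Psi.

Local Notation toC F := (fun t : R => (F t)%:C : CC R).

(** Measurability and a bound are carried along so that [F] is a bounded Borel function, to which
    the homomorphism laws and normality apply. *)
Definition agree (F : R -> R) : Prop := [/\ measurable_fun setT F,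
  exists M, forall t, `|F t| <= M & forall v, Phi (toC F) v = Psi (toC F) v].

Lemma agreeM F G : agree F -> agree G -> agree (fun t => F t * G t).
Proof.
move=> [mF [M FM] eF] [mG [N GN] eG]; split.
- exact: measurable_funM.
- by exists (M * N) => t; rewrite normrM ler_pM.
- move=> v; have -> : toC (fun t => F t * G t) = (fun t => toC F t * toC G t).
    by apply/funext => t; rewrite rmorphM.
  have bF := bounded_borel_real mF FM; have bG := bounded_borel_real mG GN.
  by rewrite (star_hom_mul Phi_hom bF bG) (star_hom_mul Psi_hom bF bG) eG eF.
Qed.

Lemma agree_lin a F G : agree F -> agree G -> agree (fun t => a * F t + G t).
Proof.
move=> [mF [M FM] eF] [mG [N GN] eG]; split.
- by apply: measurable_funD => //; exact: measurable_funM.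
- exists (`|a| * M + N) => t; apply: le_trans (ler_normD _ _) _.
  by rewrite normrM lerD// ler_wpM2l.
- move=> v.
  have -> : toC (fun t => a * F t + G t) = (fun t => a%:C * toC F t + toC G t).
    by apply/funext => t; rewrite rmorphD rmorphM.
  have bF := bounded_borel_real mF FM; have bG := bounded_borel_real mG GN.
  by rewrite (star_hom_linear Phi_hom _ bF bG) (star_hom_linear Psi_hom _ bF bG)
    eG eF.
Qed.

Lemma agreeZ a F : agree F -> agree (fun t => a * F t).
Proof.
move=> aF; have := agree_lin (a - 1) aF aF.
by congr agree; apply/funext => t; rewrite mulrBl mul1r subrK.
Qed.

(** Normality of both calculi identifies the weak limits, and a vector is determined by its inner
    products. *)
Lemma agree_lim (F : nat -> R -> R) (G : R -> R) (M : R) :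
  (forall n, agree (F n)) ->
  (forall n t, `|F n t| <= M) -> (forall t, F n t @[n --> \oo] --> G t) ->
  agree G.
Proof.
move=> aF FM Fcvg.
have mF n : measurable_fun setT (F n) by have [] := aF n.
have eF n v : Phi (toC (F n)) v = Psi (toC (F n)) v by have [] := aF n.
split.
- by apply: (measurable_fun_cvg mF) => t _; exact: Fcvg.
- exists M => t; apply: (cvgr_to_le (cvg_norm (Fcvg t))).
  by apply: nearW => n; exact: FM.
have FCcvg t : toC (F n) t @[n --> \oo] --> toC G t.
  exact: (cvg_comp (fun n => F n t) (fun x : R => x%:C : CC R)
    (Fcvg t) (@real_complex_continuous R (G t))).
have bF n := bounded_borel_real (mF n) (FM n).
have FCM n t : `|(F n t)%:C : CC R| <= M%:C by rewrite norm_real_complex lecR.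
have key v w : ip (Phi (toC G) v) w = ip (Psi (toC G) v) w.
  have c1 := @Phi_normal _ _ _ bF FCM FCcvg v w.
  have := @Psi_normal _ _ _ bF FCM FCcvg v w.
  under eq_fun do rewrite -eF.
  by move=> c2; apply: cvg_unique c1 c2; exact: norm_hausdorff.
move=> v; apply/eqP; rewrite -subr_eq0 -(dnorm_eq0 ip) linearBl/= key subrr//.
Qed.

Lemma agree_iter_newton n F : agree F ->
  agree (fun t => iter n newton_sign (F t)).
Proof.
move=> aF; elim: n => [//|n IH].
(* With u the current iterate, this is 3/2 u - 1/2 u^3 followed by (-1) u + u, which supplies the
   zero function as last summand of [agree_lin]. *)
have := agree_lin (3 / 2) IH
  (agree_lin (- 2^-1) (agreeM (agreeM IH IH) IH) (agree_lin (-1) IH IH)).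
by congr agree; apply/funext => t /=; rewrite /newton_sign; lra.
Qed.

Lemma agree_pos F : agree F -> agree (\1_[set t | 0 < F t]).
Proof.
move=> aF; have [_ [M FM] _] := aF.
have M1 : 0 < `|M| + 1 by rewrite ltr_wpDl.
(* Rescaling brings [F] into [-1, 1], where Newton's iteration converges, without changing its sign;
   the added 1 keeps the denominator positive. *)
pose c := (`|M| + 1)^-1.
have c0 : 0 < c by rewrite invr_gt0.
pose G t := c * F t.
have G1 t : `|G t| <= 1.
  rewrite /G normrM gtr0_norm// mulrC ler_pdivrMr// mul1r.
  by apply: le_trans (FM t) _; rewrite (le_trans (ler_norm _))// lerDl.
have aS : agree (fun t => Num.sg (G t)).
  apply: (@agree_lim (fun n t => iter n newton_sign (G t)) _ 1).
  - by move=> n; apply: agree_iter_newton; exact: agreeZ.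
  - by move=> n t; apply: iter_newton_le1; exact: G1.
  - by move=> t; apply: newton_sign_cvg; exact: G1.
(* For a sign s in {-1, 0, 1}, the number (s^2 + s) / 2 is 1 exactly when s = 1; the last summand -s
   + s is again a zero. *)
have := agree_lin 2^-1 (agreeM aS aS) (agree_lin 2^-1 aS (agree_lin (-1) aS aS)).
congr agree; apply/funext => t; rewrite /G sgrM (gtr0_sg c0) mul1r indicE.
have [F0|F0|F0] := ltgtP 0 (F t).
- by rewrite gtr0_sg// mem_set//=; lra.
- by rewrite ltr0_sg// memNset/=; [lra|move=> /=; rewrite ltNge (ltW F0)].
- by rewrite -F0 sgr0 memNset/=; [lra|rewrite -F0 ltxx].
Qed.

Lemma agree_indic_eq A v : agree (\1_A) -> Phi (\1_A) v = Psi (\1_A) v.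
Proof. by case=> _ _; rewrite real_complex_indic. Qed.

(** Both calculi live on the common interval [D], where its indicator plays the constant 1 and the
    truncated identity plays t. Rays are then obtained as positivity sets. *)
Lemma agree_rays (M N : R) a r :
  (forall v, Phi (\1_(`[- M, M])) v = v) ->
  (forall v, Phi (fun t : R => t%:C * \1_(`[- M, M]) t) v = a v) ->
  (forall v, Psi (\1_(`[- N, N])) v = v) ->
  (forall v, Psi (fun t : R => t%:C * \1_(`[- N, N]) t) v = a v) ->
  forall v, Phi (\1_(`]-oo, r])) v = Psi (\1_(`]-oo, r])) v /\
            Phi (\1_(`]r, +oo[)) v = Psi (\1_(`]r, +oo[)) v.
Proof.
move=> Phi1 Phia Psi1 Psia.
pose L := Num.max M N; pose D : set R := `[- L, L]%classic.
have ML : `[- M, M]%classic `<=` D.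
  by apply: subset_itv; rewrite bnd_simp ?lerN2 le_max lexx.
have NL : `[- N, N]%classic `<=` D.
  by apply: subset_itv; rewrite bnd_simp ?lerN2 le_max lexx orbT.
have mind (A : set R) : measurable A -> measurable_fun setT (\1_A : R -> R).
  by move=> mA; exact: measurable_indic.
(* Agreement may be transferred between functions that coincide on [D], since [D] contains the
   supports of both calculi. *)
have cut (F G : R -> R) (M' N' : R) :
    measurable_fun setT F -> (forall t, `|F t| <= M') ->
    measurable_fun setT G -> (forall t, `|G t| <= N') ->
    (forall t, D t -> F t = G t) -> agree F -> agree G.
  move=> mF FM mG GN FG [_ _ eF]; split=> //; first by exists N'.
  move=> v; have bF := bounded_borel_real mF FM.
  have bG := bounded_borel_real mG GN.
  rewrite -(star_hom_supported v Phi_hom (measurable_itv _) Phi1 bF bG).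
    rewrite -(star_hom_supported v Psi_hom (measurable_itv _) Psi1 bF bG) //.
    by move=> t /NL /FG ->.
  by move=> t /ML /FG ->.
have bind (A : set R) : measurable A -> bounded_borel (\1_A : R -> CC R).
  by move=> mA; rewrite -real_complex_indic;
    exact: (bounded_borel_real (mind _ mA) (abs_indic_le1 A)).
have aD : agree (\1_D).
  have mD : measurable D by exact: measurable_itv.
  split; first exact: mind.
    by exists 1; exact: abs_indic_le1.
  move=> v; rewrite real_complex_indic.
  transitivity v.
    rewrite -[RHS]Phi1; apply: (star_hom_supported v Phi_hom _ Phi1);
      do ?[exact: bind|exact/bind/measurable_itv].
    + exact: measurable_itv.
    + by move=> t Mt; rewrite !indicE !mem_set//; exact: ML.
  rewrite -[LHS]Psi1; apply: (star_hom_supported v Psi_hom _ Psi1);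
      do ?[exact: bind|exact/bind/measurable_itv].
  + exact: measurable_itv.
  + by move=> t Nt; rewrite !indicE !mem_set//; exact: NL.
(* The truncation makes the identity function bounded. Enlarging the interval from [M] or [N] to [L]
   does not change the operator, so both calculi send [J L] to [a]. *)
pose J K (t : R) : R := t * \1_(`[- K, K]) t.
have mJ K : measurable_fun setT (J K).
  by apply: measurable_funM => //; apply: mind; exact: measurable_itv.
have J_le K t : `|J K t| <= `|K|.
  rewrite /J indicE; have [|_] := boolP (t \in _); rewrite ?mulr0 ?normr0// mulr1.
  rewrite inE/= in_itv/= => tK; rewrite ler_norml.
  by have := ler_norm K; case/andP: tK; lra.
have bJ K := bounded_borel_real (mJ K) (J_le K).
have JE K : (fun t : R => (J K t)%:C : CC R) = (fun t : R => t%:C * \1_(`[- K, K]) t).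
  by apply/funext => t; rewrite /J rmorphM -real_complex_indic.
have J_eq K t : `[- K, K]%classic `<=` D -> `[- K, K]%classic t -> J K t = J L t.
  by move=> KD Kt; rewrite /J !indicE !mem_set//; exact: KD.
have aJ : agree (J L).
  split; [exact: mJ|by exists `|L|; exact: J_le|move=> v].
  transitivity (a v).
    rewrite -Phia -JE; apply: (star_hom_supported v Phi_hom _ Phi1); do ?exact: bJ.
    + exact: measurable_itv.
    + by move=> t Mt; rewrite (J_eq M).
  rewrite -Psia -JE; apply: (star_hom_supported v Psi_hom _ Psi1); do ?exact: bJ.
  + exact: measurable_itv.
  + by move=> t Nt; rewrite (J_eq N).
have aup : agree (\1_(`]r, +oo[)).
  (* On [D] the function is t - r, which is positive exactly on the open ray. *)
  have apos := agree_pos (agree_lin (- r) aD aJ).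
  have [mpos _ _] := apos.
  apply: (cut _ _ 1 1 mpos _ _ _ _ apos); do ?exact: abs_indic_le1.
    by apply: mind; exact: measurable_itv.
  move=> t Dt; rewrite !indicE; congr (nat_of_bool _)%:R.
  by apply/idP/idP; rewrite !inE/= in_itv/= andbT /J !indicE (mem_set Dt) !mulr1; lra.
have adown : agree (\1_(`]-oo, r])).
  (* On [D] the closed ray is the complement of the open one: 1 minus its indicator. *)
  have alin := agree_lin (-1) aup aD; have [mlin [B linB] _] := alin.
  apply: (cut _ _ B 1 mlin linB _ _ _ alin); do ?exact: abs_indic_le1.
    by apply: mind; exact: measurable_itv.
  move=> t Dt; rewrite !indicE (mem_set Dt).
  have [rt|tr] := ltP r t.
    by rewrite mem_set ?memNset /= ?in_itv /= ?rt ?leNgt ?rt//=; lra.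
  by rewrite memNset ?mem_set /= ?in_itv /= ?tr// ?ltNge ?tr//=; lra.
by move=> v; split; exact: agree_indic_eq.
Qed.

End Uniqueness.

(** * Lipschitz functions and propagation *)

Section Metric.
Context {R : realType} {X : metricType R}.

Lemma mdist_lipschitz (x y z : X) : `|mdist x y - mdist x z| <= mdist y z.
Proof.
rewrite ler_norml; have := metric_triangle x y z; have := metric_triangle x z y.
by rewrite (metric_sym z y); lra.
Qed.

Lemma lipschitz_continuous (f : X -> R) :
  (forall x y, `|f x - f y| <= mdist x y) -> continuous f.
Proof.
move=> fL x; apply/cvgrPdist_lt => e e0; near=> y.
apply: le_lt_trans (fL x y) _.
near: y; apply: (@metricType_numDomainType.cvgr_dist_lt _ _ _ _ _ id x).
  exact: cvg_id.
exact: e0.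
Unshelve. all: by end_near. Qed.

Lemma closed_mdist_le (x : X) (r : R) : closed [set y | mdist x y <= r].
Proof.
apply: (closed_comp _ (@closed_le R r)) => y _.
by apply: lipschitz_continuous => u v; exact: mdist_lipschitz.
Qed.

Lemma lip_seminorm_le1 (F : X -> CC R) : (lip_seminorm F <= 1)%E ->
  forall x y, `|complex.Re (F x) - complex.Re (F y)| <= mdist x y.
Proof.
move=> F1 x y; have [->|xy] := eqVneq x y.
  by rewrite subrr normr0 mdist_ge0.
have : ((complex.Re `|F x - F y| / mdist x y)%:E <= 1)%E.
  by apply: le_trans F1; apply: ereal_sup_ubound; right; exists x, y.
rewrite lee_fin ler_pdivrMr ?mdist_gt0// mul1r; apply: le_trans.
have := normc_ge_Re (F x - F y : R[i]).
by rewrite lecE => /andP[_]; rewrite raddfB.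
Qed.

Lemma lip_seminorm_real (g : X -> R) : (forall x y, `|g x - g y| <= mdist x y) ->
  (lip_seminorm (fun x => (g x)%:C : CC R) <= 1)%E.
Proof.
move=> gL; apply: ge_ereal_sup => _ [->|[x [y [xy ->]]]]; first exact: lee01.
rewrite lee_fin ler_pdivrMr ?mdist_gt0// mul1r.
by rewrite -rmorphB norm_real_complex; exact: gL.
Qed.

End Metric.

(** * Spectral projections and the two propagations *)

Section Propagation.
Context {R : realType} {X : metricType R} {H : completeNormedModType R[i]}.
Variable ip : {dot H for (@Num.conj R[i])}.
Variables rho rhoB : (X -> CC R) -> H -> H.
Hypothesis ip_norm : forall v : H, `|v| ^+ 2 = ip v v.
Hypothesis X_proper : proper_metric X.
Hypothesis rho_nondeg : nondegenerate_rep rho.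
Hypothesis rhoB_ext : borel_extension ip rho rhoB.

Let rhoB_hom : star_hom ip bounded_borel rhoB. Proof. by case: rhoB_ext. Qed.
Let rhoB_normal : sigma_normal ip rhoB. Proof. by case: rhoB_ext. Qed.

Lemma star_hom_comp (g : X -> R) : continuous g ->
  star_hom ip bounded_borel (fun h : R -> CC R => rhoB (h \o g)).
Proof.
move=> cg; have bc h := @bounded_borel_comp R X R h g cg; split.
- by move=> f /bc bf; exact: (star_hom_bounded rhoB_hom).
- by move=> a f h /bc bf /bc bh v; exact: (star_hom_linear rhoB_hom a bf bh v).
- by move=> f h /bc bf /bc bh v; exact: (star_hom_mul rhoB_hom bf bh v).
- by move=> f /bc bf u v; exact: (star_hom_adj rhoB_hom bf u v).
Qed.

Lemma sigma_normal_comp (g : X -> R) : continuous g ->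
  sigma_normal ip (fun h : R -> CC R => rhoB (h \o g)).
Proof.
move=> cg f_ f M bf fM fcvg u v.
apply: (@rhoB_normal (fun n => f_ n \o g) (f \o g) M) => [n|n x|x].
- exact: bounded_borel_comp.
- exact: fM.
- exact: fcvg.
Qed.

(** Vanishing at infinity with tolerance 1 leaves a compact set, on which continuity gives the
    bound. *)
Lemma C0_bounded (f : X -> CC R) : C0 f -> exists M : R, forall x, `|f x| <= M%:C.
Proof.
move=> [cf /(_ 1 ltr01)[K cK f1]].
have normE x : `|f x| = (complex.Re `|f x|)%:C by rewrite RRe_real// normr_real.
have cn : continuous (fun x => complex.Re `|f x| : R).
  move=> x; apply: (cvg_comp (fun x => `|f x| : CC R)); last exact: Re_continuous.
  exact: (@cvg_norm _ (CC R) _ _ _ _ _ (cf x)).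
have cpt : compact ((fun x => complex.Re `|f x| : R) @` K).
  by apply: continuous_compact => //; exact: continuous_subspaceT.
have [M [_ MK]] := compact_bounded (cpt : compact (_ : set R^o)).
exists (Num.max 1 (M + 1)) => x; rewrite normE lecR le_max.
have [Kx|/f1 fx] := pselect (K x).
  apply/orP; right; apply: le_trans (ler_norm _) _.
  by apply: (MK (M + 1)); [rewrite ltrDl|exists x].
by apply/orP; left; move: fx; rewrite normE ltcR => /ltW.
Qed.

Lemma selfadj_Re (z : R[i]) : z^* = z -> z = (complex.Re z)%:C.
Proof. by move=> /CrealP zR; rewrite RRe_real. Qed.

Lemma C0_bounded_borel (f : X -> CC R) : C0 f -> bounded_borel f.
Proof.
move=> fC0; split; first exact: C0_bounded.
move=> U oU; apply: borel_open; apply: open_comp => // x _.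
by case: fC0 => cf _; exact: cf.
Qed.

(** The operator of the constant 1 fixes every rho(f) u because 1 f = f. Its fixed vectors form a
    closed subspace, which is everything by nondegeneracy. *)
Lemma rhoB1 v : rhoB (\1_setT) v = v.
Proof.
have bT : bounded_borel (\1_setT : X -> CC R).
  by apply: bounded_borel_indic; exact: borel_open openT.
have [lE cE] := star_hom_bounded rhoB_hom bT.
pose D w := rhoB (\1_setT) w - w.
suff : [set w | D w = 0] v by move=> /eqP; rewrite subr_eq0 => /eqP.
have cD : closed [set w | D w = 0].
  apply: (@closed_comp _ _ D [set 0]) => [w _|].
    by apply: cvgB; [exact: cE|exact: cvg_id].
  apply: accessible_closed_set1; apply: hausdorff_accessible.
  exact: norm_hausdorff.
have clD : closure [set w | D w = 0] = [set w | D w = 0] by apply/esym/closure_id.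
rewrite -clD; have : [set: H] v by []; rewrite -rho_nondeg; move: v.
apply: closure_subset => _ [n [f [u [fC0 ->]]]] /=.
apply: (big_ind (fun w => D w = 0)) => [|w1 w2 D1 D2|i _].
- by rewrite /D (bounded_op0 (conj lE cE)) subrr.
- by rewrite /D (bounded_opD _ _ (conj lE cE)) opprD addrACA
    -/(D w1) -/(D w2) D1 D2 addr0.
have [_ _ /(_ _ (fC0 i)) rhoE] := rhoB_ext.
rewrite /D -rhoE -(star_hom_mul rhoB_hom bT (C0_bounded_borel (fC0 i))).
apply/eqP; rewrite subr_eq0; apply/eqP; congr (rhoB _ _).
by apply/funext => x; rewrite indicT mul1r.
Qed.

(** Taking the real part gives a map into [R], with which functions on the line can be composed; for
    self-adjoint [f] and [c] it loses nothing. *)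
Let spectral_fun (f : X -> CC R) (c : R[i]) (x : X) : R := complex.Re (f x + c).

Lemma unitization_continuous f c : C0 f -> continuous (spectral_fun f c).
Proof.
move=> [cf _] x; apply: (cvg_comp (fun x => f x + c)); last exact: Re_continuous.
by apply: cvgD; [exact: cf|exact: cvg_cst].
Qed.

Lemma unitization_calculus f c : unitization_selfadj f c ->
  is_borel_calculus ip (unitization_rep rho f c)
    (fun h => rhoB (h \o spectral_fun f c)).
Proof.
move=> [fC0 fR cR]; have cg := @unitization_continuous f c fC0.
split; [exact: star_hom_comp|exact: sigma_normal_comp|].
have [M fM] := C0_bounded fC0.
(* This bounds f + c, so the cut-off to [-N, N] is identically 1 along [spectral_fun f c]. *)
pose N := M + `|complex.Re c|.
have gN x : `[- N, N]%classic (spectral_fun f c x).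
  rewrite /= in_itv/= -ler_norml /spectral_fun raddfD.
  apply: le_trans (ler_normD _ _) _; rewrite lerD2r -lecR.
  exact: le_trans (normc_ge_Re _) (fM x).
have cut x : (\1_(`[- N, N]) : R -> CC R) (spectral_fun f c x) = 1.
  by rewrite indicE mem_set.
exists N; split=> v.
  rewrite -[RHS]rhoB1; congr (rhoB _ _); apply/funext => x.
  by rewrite /= cut indicT.
have bf := C0_bounded_borel fC0.
have b1 : bounded_borel (\1_setT : X -> CC R).
  by apply: bounded_borel_indic; exact: borel_open openT.
have [_ _ /(_ f fC0) rhoE] := rhoB_ext.
(* The scalar part c v is written as c times the operator of the constant 1 applied to v, so that
   linearity of [rhoB] reassembles f + c. *)
rewrite /unitization_rep -rhoE -{3}(rhoB1 v) addrC.
rewrite -(star_hom_linear rhoB_hom c b1 bf).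
congr (rhoB _ _); apply/funext => x; rewrite /= cut mulr1 indicT mulr1.
rewrite addrC [RHS](_ : _ = (f x + c)%R)// [RHS]selfadj_Re//.
by rewrite rmorphD/= fR cR.
Qed.

(** The existence of one calculus, given by composition, ensures that the one chosen by [xget] is a
    calculus as well; uniqueness on rays then identifies the two. *)
Lemma borel_calculus_rays f c r v : unitization_selfadj f c ->
  borel_calculus ip (unitization_rep rho f c) (\1_(`]-oo, r])) v =
    rhoB (\1_[set x | spectral_fun f c x <= r]) v /\
  borel_calculus ip (unitization_rep rho f c) (\1_(`]r, +oo[)) v =
    rhoB (\1_[set x | r < spectral_fun f c x]) v.
Proof.
move=> fc; have calc := unitization_calculus fc.
have : is_borel_calculus ip (unitization_rep rho f c)
    (borel_calculus ip (unitization_rep rho f c)).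
  apply: (@xgetPex _ _ [set Phi | is_borel_calculus ip _ Phi]).
  by exists (fun h => rhoB (h \o spectral_fun f c)).
case=> Phi_hom Phi_normal [M [Phi1 Phia]].
have [Psi_hom Psi_normal [N [Psi1 Psia]]] := calc.
have [-> ->] :=
  agree_rays Phi_hom Psi_hom Phi_normal Psi_normal r Phi1 Phia Psi1 Psia v.
split; congr (rhoB _ _); apply/funext => x; rewrite /= !indicE.
by congr (nat_of_bool _)%:R; apply/idP/idP; rewrite !inE/= in_itv/= andbT.
Qed.

Variable T : H -> H.
Hypothesis T_bounded : bounded_op T.

Lemma null_outside_support x y : ~ op_support rhoB T (x, y) ->
  exists U V, [/\ open U, open V, U x, V y &
    forall v, rhoB (\1_U) (T (rhoB (\1_V) v)) = 0].
Proof.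
by move=> /contrapT[[U V] /= [oU oV nUV] [/= Ux Vy]]; exists U, V; split.
Qed.

Lemma null_far (g : X -> R) (r : R) : continuous g ->
  (forall x y, g x <= 0 -> r < g y -> ~ op_support rhoB T (x, y)) ->
  forall v, rhoB (\1_[set x | g x <= 0]) (T (rhoB (\1_[set x | r < g x]) v)) = 0.
Proof.
move=> cg far.
have cl_le a : closed [set x | g x <= a].
  by apply: (closed_comp _ (@closed_le R a)) => x _; exact: cg.
have cl_ge a : closed [set x | a <= g x].
  by apply: (closed_comp _ (@closed_ge R a)) => x _; exact: cg.
have op_gt a : open [set x | a < g x].
  by apply: (open_comp _ (@open_gt R a)) => x _; exact: cg.
(* A base point is needed as the centre of the exhausting balls, which are compact by properness. If
   {g <= 0} is empty its projection is zero. *)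
have [[x0 _]|noA] := pselect ([set x | g x <= 0] !=set0); last first.
  move=> v; rewrite (_ : [set x | g x <= 0] = set0) ?(star_hom_indic0 rhoB_hom)//.
  by apply/seteqP; split=> // x gx; apply: noA; exists x.
pose K n := [set y | mdist x0 y <= n%:R].
have clK n : closed (K n) by exact: closed_mdist_le.
have K_near y : \forall n \near \oo, K n y.
  by apply: nbhs_infty_ger.
pose A n := [set x | g x <= 0] `&` K n.
(* The set {g > r} is open, so it is exhausted by closed sets with a margin 1 / (n + 1), which is
   positive already at n = 0. *)
pose B n := [set x | r + n.+1%:R^-1 <= g x] `&` K n.
have clA n : closed (A n) by exact: closedI.
have clB n : closed (B n) by exact: closedI.
have Bsub n : B n `<=` [set x | r < g x].
  move=> x [/= gx _]; apply: lt_le_trans gx.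
  by rewrite ltrDl invr_gt0.
apply: (@null_pair_limit _ _ _ ip_norm _ _ rhoB_hom rhoB_normal _ T_bounded A B).
- by move=> n; exact: borel_closed.
- by move=> n; exact: borel_closed.
- exact: borel_closed.
- exact: borel_open.
- by move=> n x [].
- exact: Bsub.
- by move=> x gx; apply: filterS (K_near x) => n Kx; split.
- move=> y gy; have gyr : 0 < g y - r by rewrite subr_gt0.
  near=> n; split; last by near: n; exact: K_near.
  rewrite /= -lerBrDl; apply: ltW.
  by near: n; exact: (near_infty_natSinv_lt (PosNum gyr)).
move=> n m; apply: (null_pair_compact rhoB_hom T_bounded).
- by apply: (subclosed_compact (clA n) (@X_proper x0 n%:R)) => x [].
- by apply: (subclosed_compact (clB m) (@X_proper x0 m%:R)) => x [].
- exact: borel_closed.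
- exact: borel_closed.
by move=> x y [/= gx _] /Bsub gy; apply: null_outside_support; exact: far.
Unshelve. all: by end_near. Qed.

Lemma spectral_le_classical :
  (spectral_propagation ip rho T <= classical_propagation rhoB T)%E.
Proof.
have cp0 : (0 <= classical_propagation rhoB T)%E.
  by apply: ereal_sup_ubound; left.
case cpE : (classical_propagation rhoB T) => [r||]; last 2 first.
- by rewrite leey.
- by rewrite cpE in cp0.
(* The finite value [r] of the classical propagation is itself an admissible bound in the spectral
   infimum. *)
apply: ereal_inf_lbound; exists r => //; split; first by rewrite -lee_fin -cpE.
move=> f c fc lip a v; have [fC0 _ _] := fc.
rewrite /a (borel_calculus_rays 0 _ fc).1 (borel_calculus_rays r _ fc).2.
apply: null_far v => [|x y gx gy]; first exact: unitization_continuous.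
move=> supp_xy; have : (mdist x y <= r)%R.
  by rewrite -lee_fin -cpE; apply: ereal_sup_ubound; right; exists (x, y).
(* A support point with g x <= 0 and g y > r would give r < g y - g x <= d(x, y) <= r. *)
have := lip_seminorm_le1 lip y x; rewrite metric_sym.
have := ler_norm (spectral_fun f c y - spectral_fun f c x).
rewrite /unitization_fun -/(spectral_fun f c y)
  -/(spectral_fun f c x); lra.
Qed.

Lemma classical_le_spectral :
  (classical_propagation rhoB T <= spectral_propagation ip rho T)%E.
Proof.
(* The adjoined 0 is below every admissible [r] since these are nonnegative; a support point
   remains, to be excluded if its distance exceeds [r]. *)
apply: ge_ereal_sup => _ [->|[[x y] supp_xy <-]];
  apply: le_ereal_inf_tmp => _ [r [r0 nullr] <-] //=.
rewrite lee_fin leNgt; apply/negP => rd; apply: supp_xy.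
pose d := mdist x y; pose e := (d - r) / 2.
have rd' : r < d by [].
(* Shifting by [d] makes the truncated distance vanish outside a closed ball, which is compact, so
   [h] lies in C_0(X); the remaining constant d - e goes into the scalar part. The values are g x =
   - e < 0 and g y = (d + r) / 2 > r. *)
pose h z := Num.min (mdist x z - d) 0.
pose f : X -> CC R := fun z => (h z)%:C.
pose c : R[i] := (d - e)%:C.
pose g z : R := h z + (d - e).
have hL u v : `|h u - h v| <= mdist u v.
  apply: le_trans (mdist_lipschitz x u v); rewrite /h.
  have := ler_norm (mdist x u - mdist x v).
  have := ler_norm (mdist x v - mdist x u); rewrite distrC => n1 n2.
  by rewrite ler_norml /Num.min; do 2![case: ifPn]; rewrite -?leNgt => *; lra.
have ch : continuous h by exact: lipschitz_continuous.
have fc : unitization_selfadj f c.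
  split.
  - split=> [z|eps eps0].
      exact: (cvg_comp _ _ (ch z) (@real_complex_continuous R (h z))).
    exists [set z | mdist x z <= d]; first exact: X_proper.
    move=> z /= /negP; rewrite -ltNge => dz.
    by rewrite /f /h min_r ?normr0 ?ltcR//; lra.
  - by move=> z; apply/CrealP; rewrite complex_real.
  - by apply/CrealP; rewrite complex_real.
have FE : unitization_fun f c = (fun z => (g z)%:C).
  by apply/funext => z; rewrite /unitization_fun /f /c /g [RHS]rmorphD.
have gE : spectral_fun f c = g.
  apply/funext => w.
  exact: (congr1 (fun F : X -> CC R => complex.Re (F w)) FE).
have lip : (lip_seminorm (unitization_fun f c) <= 1)%E.
  by rewrite FE; apply: lip_seminorm_real => u v;
    rewrite /g opprD addrACA subrr addr0.
have cg : continuous g.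
  by rewrite -gE; case: fc => fC0 _ _; exact: unitization_continuous.
have oU : open [set z | g z < 0].
  by apply: (open_comp _ (@open_lt R 0)) => z _; exact: cg.
have oV : open [set z | r < g z].
  by apply: (open_comp _ (@open_gt R r)) => z _; exact: cg.
exists ([set z | g z < 0], [set z | r < g z]); split=> //=.
- have bU : <<s [set V : set X | open V] >> [set z | g z <= 0].
    apply: borel_closed; apply: (closed_comp _ (@closed_le R 0)) => z _.
    exact: cg.
  (* The spectral projection belongs to the closed set {g <= 0}, while [op_support] removes open
     rectangles; the first side is therefore shrunk to {g < 0}. *)
  apply: (null_pair_mono rhoB_hom bU (borel_open oU)
    (borel_open oV) (borel_open oV)) => //.
    by move=> z /ltW.
  move=> w; have := nullr f c fc lip w.
  by rewrite (borel_calculus_rays 0 _ fc).1 (borel_calculus_rays r _ fc).2 gE.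
- by rewrite /g /h mdistxx min_l; rewrite /e; lra.
- by rewrite /g /h subrr min_l ?lexx// /e; lra.
Qed.

End Propagation.

Theorem theorem5p2 (R : realType) (X : metricType R)
    (H : completeNormedModType R[i]) (ip : {dot H for (@Num.conj R[i])})
    (rho rhoB : (X -> CC R) -> H -> H) :
  (forall v : H, `|v| ^+ 2 = ip v v) ->
  proper_metric X ->
  representation ip rho -> faithful_rep rho -> nondegenerate_rep rho ->
  borel_extension ip rho rhoB ->
  (forall T : H -> H, bounded_op T ->
     spectral_propagation ip rho T = classical_propagation rhoB T) /\
  spectral_roe_algebra ip rho = roe_algebra rho rhoB.
Proof.
move=> ip_norm X_proper _ _ rho_nondeg rhoB_ext.
have eq_prop T : bounded_op T ->
    spectral_propagation ip rho T = classical_propagation rhoB T.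
  move=> bT; apply/eqP; rewrite eq_le spectral_le_classical//=.
  exact: classical_le_spectral.
split=> //; rewrite /spectral_roe_algebra /roe_algebra; congr op_norm_closure.
(* Local compactness includes boundedness, so the equality of propagations applies to every
   generator of either algebra. *)
by apply/seteqP; split=> T [[bT lT] pT]; split=> //; rewrite ?eq_prop// -eq_prop.
Qed.
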